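(* Let $a>0$, $\Omega=(-a,a)$, $a_0>0$, $a_1,a_2,a_3\in\mathbb{R}$, and let $w\in C^{2+\gamma}(\Omega)$ for some $0<\gamma<1$ with $\frac{\partial^i w}{\partial x^i}(-a)=\frac{\partial^i w}{\partial x^i}(a)$ for $i=0,1,2$. Let $h_0\in H^1(\Omega)$ be nonnegative with $\int_\Omega \frac{1}{h_0(x)}\,dx<\infty$, and suppose that either (1) $h_0(-a)=h_0(a)=0$, or (2) $h_0(-a)=h_0(a)\neq 0$ and $\frac{\partial^i h_0}{\partial x^i}(-a)=\frac{\partial^i h_0}{\partial x^i}(a)$ holds for $i=1,2,3$. Let $T_{loc}>0$ and let $h$ be a nonnegative generalized weak solution of problem (P) on $Q_{T_{loc}}$ with initial data $h_0$ such that $h\in L^2(0,T_{loc};H^2(\Omega))$ and $$\mathcal{E}_0(T_{loc})+\iint_{\{h>0\}} h^3(a_0h_{xxx}+a_1h_x+a_2w')^2\,dx\,dt\le \mathcal{E}_0(0)+K\,T_{loc},\qquad K=|a_2a_3|\,\|w'\|_\infty\,C,$$ for a finite constant $C$, where $\{h>0\}\subset Q_{T_{loc}}$. Let $M=\int_\Omega h_0\,dx$. Then $$\frac{a_0}{4}\,\|h(\cdot,T_{loc})\|_{H^1(\Omega)}^2\le \mathcal{E}_0(0)+K\,T_{loc}+K_3,$$ where $$K_3=\begin{cases}|a_2|\,\|w\|_\infty M & \text{if } a_0+a_1\le0,\\[2pt] |a_2|\,\|w\|_\infty M+M^2\left(\dfrac{2\sqrt6\,(a_0+a_1)^{3/2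}}{3\sqrt{a_0}}+\dfrac{a_0+a_1}{2|\Omega|}\right)&\text{otherwise.}\end{cases}$$
   Context: Notation: $Q_T=\Omega\times(0,T)$, $f(h)=|h|^3$, $\|\cdot\|_\infty$ is the sup norm on $\Omega$, $\|u\|_{H^1(\Omega)}^2=\int_\Omega(u^2+u_x^2)\,dx$, $\langle\cdot,\cdot\rangle$ is the duality pairing between $(H^1(\Omega))'$ and $H^1(\Omega)$. $C^{\alpha,\beta}_{x,t}$ denotes functions Hölder continuous with exponent $\alpha$ in $x$ and $\beta$ in $t$; $C^{4,1}_{x,t}$ denotes functions with four continuous $x$-derivatives and one continuous $t$-derivative. Problem (P): $h_t+\big(f(h)(a_0h_{xxx}+a_1h_x+a_2w'(x))\big)_x+a_3h_x=0$ in $Q_T$; $\frac{\partial^i h}{\partial x^i}(-a,t)=\frac{\partial^i h}{\partial x^i}(a,t)$ for $t>0$, $i=0,1,2,3$; $h(x,0)=h_0(x)\ge0$. Definition. A generalized weak solution of (P) on $Q_T$ is a function $h$ with (i) $h\in C^{1/2,1/8}_{x,t}(\overline Q_T)\cap L^\infty(0,T;H^1(\Omega))$; (ii) $h_t\in L^2(0,T;(H^1(\Omega))')$; (iii) $h\in C^{4,1}_{x,t}(\mathcal P)$ and $\sqrt{f(h)}\,(a_0h_{xxx}+a_1h_x+a_2w')\in L^2(\mathcal P)$, where $\mathcal P=\overline Q_T\setminus(\{h=0\}\cup\{t=0\})$; (iv) for all $\phi\in C^1(\overline Q_T)$ with $\phi(-a,\cdot)=\phi(a,\cdot)$, $$\int_0^T\langle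 h_t(\cdot,t),\phi\rangle\,dt-\iint_{\mathcal P}f(h)(a_0h_{xxx}+a_1h_x+a_2w'(x))\phi_x\,dx\,dt-a_3\iint_{Q_T}h\phi_x\,dx\,dt=0;$$ (v) $h(\cdot,t)\to h(\cdot,0)=h_0$ pointwise and strongly in $L^2(\Omega)$ as $t\to0$; (vi) $h(-a,t)=h(a,t)$ for all $t\in[0,T]$, and $\frac{\partial^i h}{\partial x^i}(-a,t)=\frac{\partial^i h}{\partial x^i}(a,t)$ for $i=1,2,3$ at all points of the lateral boundary where $h\ne0$. Energy: $\mathcal E_0(T):=\frac12\int_\Omega\big(a_0h_x^2(x,T)-a_1h^2(x,T)-2a_2w(x)h(x,T)\big)\,dx$; in particular $\mathcal E_0(0)$ is computed with $h_0$. *)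

(* Defs.v *)
From HB Require Import structures.
From mathcomp Require Import all_boot all_order all_algebra.
From mathcomp Require Import all_classical all_reals all_analysis.

Set Implicit Arguments.
Unset Strict Implicit.
Unset Printing Implicit Defensive.

Import Order.TTheory GRing.Theory Num.Theory.
Import numFieldNormedType.Exports.

Local Open Scope classical_set_scope.
Local Open Scope ring_scope.

Section differentiation_within.
Context {R : realType}.
Implicit Types (D : set R) (f : R -> R) (x : R) (n : nat).

(* Derivatives relative to D: one-sided at the endpoints of a closed interval,
   the usual ones at interior points.  [deriv_in] is meaningful only where
   [derivable_in] holds. *)
Definition diffq f x : R -> R := fun y => (f y - f x) / (y - x).

Definition derivable_in D f x : Prop := cvg (diffq f x @ within D x^').

Definition deriv_in D f x : R := lim (diffq f x @ within D x^').

Definition nderiv_in D n f : R -> R := iter n (deriv_in D) f.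

(* f is n times differentiable at x relative to D: the derivatives of order
   less than n exist near x, the one of order n exists at x. *)
Definition nderivable_at D n f x : Prop :=
  forall k, (k < n)%N ->
    derivable_in D (nderiv_in D k f) x /\
    ((k.+1 < n)%N -> \forall y \near within D (nbhs x),
                       derivable_in D (nderiv_in D k f) y).

Definition hoelder_in D (gamma : R) f : Prop :=
  exists C : R, forall x y, D x -> D y -> `|f x - f y| <= C * `|x - y| `^ gamma.

(* C^{n+gamma} on an interval D *)
Definition Cn_hoelder D n (gamma : R) f : Prop :=
  (forall k, (k < n)%N -> forall x, D x -> derivable_in D (nderiv_in D k f) x)
  /\ hoelder_in D gamma (nderiv_in D n f).

(* C^1 functions on the line with compact support contained in D *)
Definition C1c D f : Prop :=
  [/\ forall x, derivable f x 1, continuous (derive1 f),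
      compact (closure [set x | f x != 0]) &
      closure [set x | f x != 0] `<=` D].

Definition supnorm D f : R := sup [set `|f x| | x in D].

End differentiation_within.

Section sobolev.
Context {R : realType}.
Local Notation mu := (@lebesgue_measure R).
Implicit Types (D : set R) (u v psi : R -> R).

Definition L2_space d (T : measurableType d) (m : {measure set T -> \bar R})
    (D : set T) (f : T -> R) : Prop :=
  measurable_fun D f /\ m.-integrable D (fun x => (f x ^+ 2)%:E).

(* D is meant to be a bounded open interval.  In dimension one, testing
   against C^1_c functions is Brezis' definition of W^{1,2} and is equivalent
   to testing against smooth ones. *)
Definition weak_deriv_of D u v : Prop :=
  forall phi, C1c D phi ->
    \int[mu]_(x in D) (u x * derive1 phi x) = - \int[mu]_(x in D) (v x * phi x).

Definition H1_space D u : Prop :=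
  L2_space mu D u /\ exists v, L2_space mu D v /\ weak_deriv_of D u v.

(* the weak derivative of u in H^1(D), unique up to a null set *)
Definition wderiv D u : R -> R :=
  xget (cst 0) [set v | L2_space mu D v /\ weak_deriv_of D u v].

Definition H1norm D u : R :=
  Num.sqrt (\int[mu]_(x in D) (u x ^+ 2 + wderiv D u x ^+ 2)).

Definition H2_space D u : Prop := H1_space D u /\ H1_space D (wderiv D u).

Definition H2norm D u : R :=
  Num.sqrt (\int[mu]_(x in D)
    (u x ^+ 2 + wderiv D u x ^+ 2 + wderiv D (wderiv D u) x ^+ 2)).

(* The topological dual of H^1(D).  Elements of H^1(D) are represented by
   functions R -> R, hence functionals by maps (R -> R) -> R, of which only
   the values on H^1(D) matter. *)
Definition H1dual D (l : (R -> R) -> R) : Prop :=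
  (forall (c : R) u v, H1_space D u -> H1_space D v ->
     l (fun x => c * u x + v x) = c * l u + l v) /\
  exists C : R, forall u, H1_space D u -> `|l u| <= C * H1norm D u.

Definition H1dual_norm D (l : (R -> R) -> R) : R :=
  sup [set `|l psi| | psi in [set psi | H1_space D psi /\ H1norm D psi <= 1]].

End sobolev.

(* Bochner spaces on (0, T).  The normed space is given by the set X of its
   elements inside a group V and by its norm N on X. *)
Section bochner.
Context {R : realType}.
Local Notation mu := (@lebesgue_measure R).
Variables (V : zmodType) (X : set V) (N : V -> R) (T : R).

Definition simple_fun (s : R -> V) : Prop :=
  [/\ forall t, 0 < t < T -> X (s t),
      finite_set (s @` `]0, T[) &
      forall v, measurable (`]0, T[ `&` s @^-1` [set v])].

Definition strongly_measurable (u : R -> V) : Prop :=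
  exists s : nat -> R -> V,
    (forall n, simple_fun (s n)) /\
    {ae mu, forall t, 0 < t < T ->
       X (u t) /\ (fun n => N (s n t - u t)) @ \oo --> (0 : R)}.

Definition L2_bochner (u : R -> V) : Prop :=
  strongly_measurable u /\
  (\int[mu]_(t in `]0%R, T[) (N (u t) ^+ 2)%:E < +oo)%E.

Definition Linfty_bochner (u : R -> V) : Prop :=
  strongly_measurable u /\
  exists C : R, {ae mu, forall t, 0 < t < T -> N (u t) <= C}.

End bochner.

Section thin_film.
Context {R : realType}.
Local Notation mu := (@lebesgue_measure R).
Local Notation mu2 := (@lebesgue_measure R \x @lebesgue_measure R)%E.

Definition Omega (a : R) : set R := `]- a, a[.
Definition Omega_bar (a : R) : set R := `[- a, a].

(* space-time functions take (x, t) as argument *)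
Definition QT (a T : R) : set (R * R) :=
  [set z | - a < z.1 < a /\ 0 < z.2 < T].
Definition QT_bar (a T : R) : set (R * R) :=
  [set z | - a <= z.1 <= a /\ 0 <= z.2 <= T].

(* classical partial derivatives relative to the closed cylinder *)
Definition dx (a : R) (n : nat) (h : R * R -> R) (z : R * R) : R :=
  nderiv_in (Omega_bar a) n (fun y => h (y, z.2)) z.1.
Definition dt (T : R) (h : R * R -> R) (z : R * R) : R :=
  deriv_in `[0, T] (fun s => h (z.1, s)) z.2.
Definition dx_exists (a : R) (n : nat) (h : R * R -> R) (z : R * R) : Prop :=
  derivable_in (Omega_bar a) (fun y => dx a n h (y, z.2)) z.1.
Definition dt_exists (T : R) (h : R * R -> R) (z : R * R) : Prop :=
  derivable_in `[0, T] (fun s => h (z.1, s)) z.2.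

(* C^{n,1}_{x,t} on a relatively open subset P of the closed cylinder *)
Definition Cn1 (a T : R) (P : set (R * R)) (n : nat) (h : R * R -> R) : Prop :=
  [/\ forall k, (k < n)%N -> forall z, P z -> dx_exists a k h z,
      forall k, (k <= n)%N -> {within P, continuous (dx a k h)},
      forall z, P z -> dt_exists T h z &
      {within P, continuous (dt T h)}].

Definition hoelder_xt (D : set (R * R)) (alpha beta : R) (h : R * R -> R)
    : Prop :=
  exists C : R, forall z1 z2, D z1 -> D z2 ->
    `|h z1 - h z2| <= C * (`|z1.1 - z2.1| `^ alpha + `|z1.2 - z2.2| `^ beta).

(* the curve t |-> h(., t) *)
Definition slice (h : R * R -> R) (t : R) : R -> R := fun x => h (x, t).

Definition mobility (s : R) : R := `|s| ^+ 3.

Definition flux (a a0 a1 a2 : R) (w : R -> R) (h : R * R -> R) (z : R * R) : R :=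
  a0 * dx a 3 h z + a1 * dx a 1 h z + a2 * nderiv_in (Omega_bar a) 1 w z.1.

(* xi is the derivative of t |-> h(., t) in the sense of distributions on
   (0, T) with values in (H^1)', where L^2 is embedded in (H^1)' as usual. *)
Definition time_derivative_of (a T : R) (h : R * R -> R)
    (xi : R -> (R -> R) -> R) : Prop :=
  forall psi eta, H1_space (Omega a) psi -> C1c (`]0, T[) eta ->
    \int[mu]_(t in `]0, T[)
       ((\int[mu]_(x in Omega a) (h (x, t) * psi x)) * derive1 eta t) =
    - \int[mu]_(t in `]0, T[) (xi t psi * eta t).

Definition positivity_domain (a T : R) (h : R * R -> R) : set (R * R) :=
  [set z | [/\ QT_bar a T z, h z != 0 & z.2 != 0]].

Record generalized_weak_solution (a a0 a1 a2 a3 : R) (w h0 : R -> R) (T : R)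
    (h : R * R -> R) : Prop := {
  gws_hoelder : hoelder_xt (QT_bar a T) (1 / 2) (1 / 8) h;
  gws_Linfty_H1 :
    Linfty_bochner (H1_space (Omega a)) (H1norm (Omega a)) T (slice h);
  gws_C41 : Cn1 a T (positivity_domain a T h) 4 h;
  gws_flux : L2_space mu2 (positivity_domain a T h)
    (fun z => Num.sqrt (mobility (h z)) * flux a a0 a1 a2 w h z);
  gws_weak : exists xi : R -> (R -> R) -> R,
    [/\ L2_bochner (H1dual (Omega a)) (H1dual_norm (Omega a)) T xi,
        time_derivative_of a T h xi &
        forall phi : R * R -> R, Cn1 a T (QT_bar a T) 1 phi ->
          (forall t, 0 <= t <= T -> phi (- a, t) = phi (a, t)) ->
          \int[mu]_(t in `]0, T[) xi t (slice phi t)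
          - \int[mu2]_(z in positivity_domain a T h)
              (mobility (h z) * flux a a0 a1 a2 w h z * dx a 1 phi z)
          - a3 * \int[mu2]_(z in QT a T) (h z * dx a 1 phi z) = 0];
  gws_initial : forall x, - a <= x <= a -> h (x, 0) = h0 x;
  gws_initial_pointwise : forall x, - a <= x <= a ->
    h (x, t) @[t --> 0^'+] --> h0 x;
  gws_initial_L2 :
    \int[mu]_(x in Omega a) ((h (x, t) - h0 x) ^+ 2) @[t --> 0^'+] --> (0 : R);
  gws_periodic : forall t, 0 <= t <= T -> h (- a, t) = h (a, t);
  gws_periodic_deriv : forall t, 0 < t <= T -> h (a, t) != 0 ->
    forall i, (1 <= i <= 3)%N -> dx a i h (- a, t) = dx a i h (a, t)
}.

(* the energy of a profile u, with the usual convention that it is infinite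
   outside H^1 *)
Definition energy (a a0 a1 a2 : R) (w u : R -> R) : \bar R :=
  if `[< H1_space (Omega a) u >] then
    (2^-1 * \int[mu]_(x in Omega a)
       (a0 * wderiv (Omega a) u x ^+ 2 - a1 * u x ^+ 2 - 2 * a2 * w x * u x))%:E
  else +oo%E.

Definition dissipation (a a0 a1 a2 : R) (w : R -> R) (T : R) (h : R * R -> R)
    : \bar R :=
  (\int[mu2]_(z in QT a T `&` [set z | (0 < h z)%R])
     (h z ^+ 3 * flux a a0 a1 a2 w h z ^+ 2)%:E)%E.

Definition K3 (a a0 a1 a2 : R) (w : R -> R) (M : R) : R :=
  let wM := `|a2| * supnorm (Omega a) w * M in
  if a0 + a1 <= 0 then wM
  else wM + M ^+ 2 *
    (2 * Num.sqrt 6 * (a0 + a1) `^ (3 / 2) / (3 * Num.sqrt a0)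
     + (a0 + a1) / (2 * fine (mu (Omega a)))).

End thin_film.

(* Main.v *)
Require Import Defs.
From HB Require Import structures.
From mathcomp Require Import all_boot all_order all_algebra.
From mathcomp Require Import all_classical all_reals all_analysis.
From mathcomp Require Import measurable_realfun ring lra.

(** Write [u = h(., T)], [s = a0 + a1], [L = 2a] and [v] for the weak derivative
of [u].  The dissipation is nonnegative, so the hypothesis bounds the energy of
[u] by [E0(0) + K T]; in particular that energy is finite and [u] is in [H^1].
It remains to bound the energy from below by [a0/4 |u|_{H^1}^2 - K3], an
inequality between functionals of a nonnegative continuous [u] in [H^1] with
integral [M] ([energy_coercive]).

Since [u >= 0], the [w]-term of the energy is at most [|a2| |w|_oo M], and what
is left to prove is [s/2 int u^2 <= a0/4 int u^2 + a0/4 int v^2 + (the remaining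
part of K3)].  When [s <= 0] this is immediate.  Otherwise one needs an
interpolation inequality between the mass and the Dirichlet integral, and a very
elementary one suffices.  By Young's inequality the oscillation of [u] between
two points at distance at most [d] is at most [lam/2 int v^2 + d/(2 lam)], for
every [lam > 0] ([weak_deriv_osc]).  Averaging over an interval of length
[d <= L] around a point [x] gives [u x <= M/d + lam/2 int v^2 + d/(2 lam)], hence
[int u^2 <= M (M/d + lam/2 int v^2 + d/(2 lam))] ([weak_deriv_interpolation]).
The choices [lam = a0/(s M)] and [d = min(L, sqrt(a0/s))] give the claim with
the constant [3/4] where [2 sqrt 6 / 3] is stated ([interpolation_young]).

The integral of [u] equals that of [h0] because mass is conserved: testing the
equation with functions of [t] alone annihilates every flux term, so the
continuous function [t |-> int h(x, t) dx] has weak derivative zero, and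
[weak_deriv_osc] with [v = 0] and [lam] tending to infinity makes it constant
([mass_conservation]).

The oscillation bound itself comes from testing the weak derivative with the
difference of two smoothed Heaviside functions, which rise just to the right of
the two points. *)

Set Implicit Arguments.
Unset Strict Implicit.
Unset Printing Implicit Defensive.

Import Order.TTheory GRing.Theory Num.Theory.
Import numFieldNormedType.Exports.

Local Open Scope classical_set_scope.
Local Open Scope ring_scope.

(** * Almost everywhere equality without measurability *)

Section eq_integral_ae.
Context d (T : measurableType d) (R : realType) (mu : {measure set T -> \bar R}).
Local Open Scope ereal_scope.
Import HBSimple HBNNSimple.

(** The real line carries its Borel sigma-algebra, so a function that is equal
almost everywhere to a Borel function may fail to be measurable.  The integrals
agree all the same: that of a nonnegative function is a supremum over the simple
functions below it, and cutting a simple function off on a null set preserves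
its integral.  This serves the time derivative [xi], which takes linear
functionals as values for almost every time only. *)
Lemma eq_integral_ae (D : set T) (f g : T -> \bar R) :
  {ae mu, forall x, D x -> f x = g x} ->
  \int[mu]_(x in D) f x = \int[mu]_(x in D) g x.
Proof.
move=> [N [mN N0 fgN]].
have sup_le (F G : T -> \bar R) : (forall x, 0 <= G x) ->
    (forall x, ~ N x -> F x = G x) ->
    ereal_sup [set sintegral mu k |
        k in [set k : {nnsfun T >-> R} | forall x, (k x)%:E <= F x]] <=
    ereal_sup [set sintegral mu k |
        k in [set k : {nnsfun T >-> R} | forall x, (k x)%:E <= G x]].
  move=> G0 FG; apply: ge_ereal_sup => _ [k /= kF <-].
  have mNC := measurableC mN.
  pose k' := mul_nnsfun k (indic_nnsfun R mNC).
  have kk' x : ~ N x -> k' x = k x.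
    by move=> Nx; rewrite /= /k' /= mindicE mem_set// mulr1.
  have -> : sintegral mu k = sintegral mu k'.
    rewrite -!integralT_nnsfun; apply: ge0_ae_eq_integral => //.
    - exact/measurable_EFinP.
    - exact/measurable_EFinP.
    - by move=> x _; rewrite lee_fin.
    - by move=> x _; rewrite lee_fin.
    - exists N; split => // x /=; apply: contra_notP => Nx _.
      by congr EFin; apply/esym; exact: kk'.
  apply: ereal_sup_ubound; exists k' => //= x.
  have [Nx|Nx] := pselect (N x); last first.
    rewrite -FG//; apply: le_trans (kF x); rewrite lee_fin.
    by rewrite [leLHS](kk' _ Nx).
  rewrite /k' /= mindicE memNset ?mulr0//; exact: G0.
have patchN x : ~ N x -> (f \_ D) x = (g \_ D) x.
  move=> Nx; rewrite !patchE; case: ifPn => // /set_mem Dx.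
  by apply: contrapT => fg; apply: Nx; apply: fgN => /=; exact/not_implyP.
rewrite /integral; congr (_ - _); apply/eqP; rewrite eq_le;
  apply/andP; split; apply: sup_le => x.
- exact: funepos_ge0.
- by move=> Nx; rewrite funeposE [RHS]funeposE (patchN _ Nx).
- exact: funepos_ge0.
- by move=> Nx; rewrite funeposE [RHS]funeposE (patchN _ Nx).
- exact: funeneg_ge0.
- by move=> Nx; rewrite funenegE [RHS]funenegE (patchN _ Nx).
- exact: funeneg_ge0.
- by move=> Nx; rewrite funenegE [RHS]funenegE (patchN _ Nx).
Qed.

End eq_integral_ae.

(** * A smoothed Heaviside function of class C^1 *)

Section step.
Context {R : realType}.
Implicit Types x e s z : R.

Definition pos2 z : R := Num.max 0 z ^+ 2.

(** The error of the first order expansion is at most [h ^+ 2], uniformly in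
[z], the corner [z = 0] included. *)
Lemma is_derive_pos2 z : is_derive z 1 (pos2 : R -> R) (2 * Num.max 0 z).
Proof.
suff H : h^-1 *: (pos2 (h + z) - pos2 z) @[h --> 0^'] --> 2 * Num.max 0 z.
  apply: DeriveDef.
    apply/cvg_ex; exists (2 * Num.max 0 z : R).
    by under eq_fun do rewrite /= [_ *: 1]mulr1; exact: H.
  rewrite /derive; under eq_fun do rewrite /= [_ *: 1]mulr1; exact/cvg_lim.
apply/cvgrPdist_le => e e0; near=> h.
have h0 : h != 0 by near: h; exact: nbhs_dnbhs_neq.
have he : `|h| <= e by near: h; exact: dnbhs0_le.
apply: le_trans he.
rewrite -(ler_pM2l (_ : 0 < `|h|)) ?normr_gt0// -normrM.
rewrite mulrBr -[_ *: _]/(_ * _) mulVKf//.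
rewrite -normrM -[h * h]expr2 [leRHS]ger0_norm ?sqr_ge0//.
rewrite /pos2 ler_norml !expr2 /Num.max; case: ifPn; case: ifPn => *;
  by apply/andP; split; nra.
Unshelve. all: by end_near. Qed.

(** The quadratic spline that rises from [0] to [1] on [[x, x + e]]. *)
Definition step x e s : R :=
  let z := (s - x) / e in 2 * pos2 z - 4 * pos2 (z - 2^-1) + 2 * pos2 (z - 1).

(** The derivative of [step x e], the tent of mass one on [[x, x + e]]. *)
Definition dstep x e s : R :=
  let z := (s - x) / e in
  e^-1 * (4 * Num.max 0 z - 8 * Num.max 0 (z - 2^-1) + 4 * Num.max 0 (z - 1)).

Lemma is_derive_step x e s : is_derive s 1 (step x e : R -> R) (dstep x e s).
Proof.
have comp c : is_derive s 1 (pos2 \o (fun s => (s - x) / e - c))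
    (e^-1 * (2 * Num.max 0 ((s - x) / e - c))).
  have ? := is_derive_pos2 ((s - x) / e - c).
  have ? : is_derive s 1 (fun s : R => (s - x) / e - c) e^-1.
    by apply: is_derive_eq; rewrite /= scaler0 add0r !subr0 [_ *: 1]mulr1.
  rewrite mulrC; exact: is_derive1_comp.
have c0 := comp 0; have c1 := comp (2^-1); have c2 := comp 1.
have -> : step x e = (2 \*: (pos2 \o (fun s => (s - x) / e - 0)))
   - (4 \*: (pos2 \o (fun s => (s - x) / e - 2^-1)))
   + (2 \*: (pos2 \o (fun s => (s - x) / e - 1))).
  by apply/funext => t; rewrite /step !fctE /= subr0.
apply: is_derive_eq.
by rewrite /dstep subr0 /GRing.scale /=; ring.
Qed.

Lemma step_le x e s : 0 < e -> s <= x -> step x e s = 0.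
Proof.
move=> e0 sx; rewrite /step.
have : (s - x) / e <= 0 by rewrite pmulr_lle0 ?invr_gt0// subr_le0.
move: (_ / e) => z z0; rewrite /pos2 !expr2 /Num.max; repeat case: ifPn => *; nra.
Qed.

Lemma step_ge x e s : 0 < e -> x + e <= s -> step x e s = 1.
Proof.
move=> e0 sx; rewrite /step.
have : 1 <= (s - x) / e by rewrite ler_pdivlMr// mul1r; lra.
move: (_ / e) => z z0; rewrite /pos2 !expr2 /Num.max; repeat case: ifPn => *; nra.
Qed.

Lemma step_itv x e s : 0 <= step x e s <= 1.
Proof.
rewrite /step; move: (_ / e) => z; rewrite /pos2 !expr2 /Num.max.
by repeat case: ifPn => *; apply/andP; split; nra.
Qed.

Lemma dstep_ge0 x e s : 0 < e -> 0 <= dstep x e s.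
Proof.
move=> e0; rewrite /dstep mulr_ge0 ?invr_ge0 ?(ltW e0)//.
move: (_ / e) => z; rewrite /Num.max.
by repeat case: ifPn => *; lra.
Qed.

Lemma dstep_out x e s : 0 < e -> (s <= x \/ x + e <= s) -> dstep x e s = 0.
Proof.
move=> e0 sx; rewrite /dstep.
have : (s - x) / e <= 0 \/ 1 <= (s - x) / e.
  case: sx => sx; [left|right].
    by rewrite pmulr_lle0 ?invr_gt0// subr_le0.
  by rewrite ler_pdivlMr// mul1r; lra.
move: (_ / e) => z z0; rewrite /Num.max; apply/eqP.
rewrite mulf_eq0; apply/orP; right.
by apply/eqP; repeat case: ifPn => *; lra.
Qed.

Lemma continuous_dstep x e : continuous (dstep x e : R -> R).
Proof.
have mx c : continuous (fun s : R => Num.max 0 ((s - x) / e - c)).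
  move=> s; apply: (@continuous_max _ _ (cst 0) (fun s => (s - x) / e - c)).
    exact: cvg_cst.
  apply: cvgB; last exact: cvg_cst.
  apply: cvgMl; apply: cvgB; [exact: cvg_id|exact: cvg_cst].
move=> s; rewrite /dstep.
apply: cvgMr; apply: cvgD; [apply: cvgB|]; apply: cvgMr => //; try exact: mx.
have := mx 0 s; by under eq_fun do rewrite subr0.
Qed.

End step.

(** * Oscillation of a function with weak derivative in L^2 *)

Section oscillation.
Context {R : realType}.
Local Notation mu := (@lebesgue_measure R).

Lemma hoelder_in_continuous (D : set R) (r : R) (f : R -> R) :
  0 < r -> hoelder_in D r f -> {within D, continuous f}.
Proof.
move=> r0 [C fC]; apply/subspace_continuousP => x Dx.
apply/cvgrPdist_le => e e0; rewrite near_withinE.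
pose C' := `|C| + 1; have C'0 : 0 < C' by rewrite ltr_wpDl.
pose del := (e / C') `^ r^-1.
have del0 : 0 < del by rewrite powR_gt0// divr_gt0.
near=> y => Dy.
have xy : `|x - y| <= del.
  by near: y; apply: cvgr_dist_le => //; exact: cvg_id.
apply: (le_trans (fC _ _ Dx Dy)).
apply: (@le_trans _ _ (C' * `|x - y| `^ r)).
  by rewrite ler_wpM2r ?powR_ge0// /C' (le_trans (ler_norm _))// lerDl.
rewrite mulrC -ler_pdivlMr//.
apply: (@le_trans _ _ (del `^ r)).
  by rewrite ge0_ler_powR ?nnegrE ?(ltW r0) ?(ltW del0).
by rewrite /del -powRrM mulVf ?gt_eqF// powRr1// divr_ge0 ?ltW.
Unshelve. all: by end_near. Qed.

Lemma continuous_integrable_oo (A B : R) (f : R -> R) :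
  {within `[A, B], continuous f} -> mu.-integrable `]A, B[ (EFin \o f).
Proof.
move=> cf; apply: (@integrableS _ _ _ mu `[A, B]) => //.
  exact: subset_itv_oo_cc.
by apply: continuous_compact_integrable => //; exact: segment_compact.
Qed.

Lemma Rintegral_dstep (A B x e : R) : A < x -> 0 < e -> x + e < B ->
  \int[mu]_(s in `]A, B[) dstep x e s = 1.
Proof.
move=> Ax e0 xB.
have AB : A < B by lra.
have cd : {within `[A, B], continuous (dstep x e)}.
  exact/continuous_subspaceT/continuous_dstep.
have cs : continuous (step x e : R -> R).
  by move=> s; apply: differentiable_continuous; apply/derivable1_diffP;
    have [] := is_derive_step x e s.
rewrite Rintegral_itv_bndo_bndc; last exact: continuous_integrable_oo.
rewrite Rintegral_itv_obnd_cbnd; last first.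
  apply: (@integrableS _ _ _ mu `[A, B]) => //; first exact: subset_itv_oc_cc.
  by apply: continuous_compact_integrable => //; exact: segment_compact.
rewrite /Rintegral (continuous_FTC2 (F := step x e) AB)//.
- by rewrite /= step_ge ?step_le ?subr0//; lra.
- split=> //.
  + by move=> s _; have [] := is_derive_step x e s.
  + apply: cvg_at_right_filter; exact: cs.
  + apply: cvg_at_left_filter; exact: cs.
- by move=> s _; rewrite derive1E; apply: derive_val; exact: is_derive_step.
Qed.

(** The tents [dstep x e] form an approximate identity at [x]. *)
Lemma Rintegral_dstep_approx (A B x e eta : R) (u : R -> R) :
  {within `[A, B], continuous u} -> A < x -> 0 < e -> x + e < B ->
  (forall s, x <= s <= x + e -> `|u s - u x| <= eta) ->
  `|\int[mu]_(s in `]A, B[) (u s * dstep x e s) - u x| <= eta.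
Proof.
move=> cu Ax e0 xB uE.
have cd : {within `[A, B], continuous (dstep x e)}.
  exact/continuous_subspaceT/continuous_dstep.
have cud : {within `[A, B], continuous (fun s => u s * dstep x e s)}.
  by move=> s; apply: cvgM; [exact: cu|exact: cd].
have cuxd c : {within `[A, B], continuous (fun s => c * dstep x e s)}.
  by move=> s; apply: cvgMr; exact: cd.
have id := continuous_integrable_oo cd.
have iud := continuous_integrable_oo cud.
have icd c := continuous_integrable_oo (cuxd c).
have -> : u x = \int[mu]_(s in `]A, B[) (u x * dstep x e s).
  by rewrite RintegralZl// Rintegral_dstep// mulr1.
rewrite -RintegralB//.
have iud2 : mu.-integrable `]A, B[
    (EFin \o (fun s => u s * dstep x e s - u x * dstep x e s)).
  by apply: continuous_integrable_oo => s; apply: cvgB; [exact: cud|exact: cuxd].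
apply: (le_trans (le_normr_Rintegral _ iud2)) => //.
rewrite -[leRHS]mulr1 -(Rintegral_dstep Ax e0 xB) -RintegralZl//.
apply: le_Rintegral => //.
- exact: (integrable_norm iud2).
- move=> s _; rewrite -mulrBl normrM (ger0_norm (dstep_ge0 _ _ e0)).
  have [xs|xs] := boolP (x <= s <= x + e).
    by rewrite ler_wpM2r ?dstep_ge0 ?uE.
  rewrite dstep_out ?mulr0//.
  by move: xs; rewrite negb_and -!ltNge => /orP[/ltW|/ltW]; [left|right].
Qed.

(** With [phi = step x e - step y e], the integral of [u * phi'] is close to
[u x - u y], whereas [|v * phi|] is at most [lam/2 * v^2 + 1/(2 lam)] on the
support [[x, y + e]] of [phi], by Young's inequality and [|phi| <= 1]. *)
Lemma weak_deriv_osc_approx (A B lam x y e eta : R) (u v : R -> R) :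
  {within `[A, B], continuous u} -> L2_space mu `]A, B[ v ->
  weak_deriv_of `]A, B[ u v -> 0 < lam ->
  A < x -> x <= y -> 0 < e -> y + e < B ->
  (forall s, x <= s <= x + e -> `|u s - u x| <= eta) ->
  (forall s, y <= s <= y + e -> `|u s - u y| <= eta) ->
  `|u y - u x| <= lam / 2 * \int[mu]_(s in `]A, B[) (v s ^+ 2)
     + (y - x + e) / (2 * lam) + 2 * eta.
Proof.
move=> cu [mv iv2] uv lam0 Ax xy e0 yB ux uy.
(* with the integrals as plain numbers, this is the final triangle inequality *)
have num (p q X Y Z b : R) : X - Y = - Z -> `|X - p| <= eta ->
    `|Y - q| <= eta -> `|Z| <= b -> `|q - p| <= b + 2 * eta.
  rewrite !ler_norml => XYZ /andP[? ?] /andP[? ?] /andP[? ?].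
  by apply/andP; split; lra.
have xB : x + e < B by lra.
have Ay : A < y by lra.
pose phi s := step x e s - step y e s.
have dphi (s : R) : is_derive s 1 (phi : R -> R) (dstep x e s - dstep y e s).
  have ? := is_derive_step x e s; have ? := is_derive_step y e s.
  by rewrite /phi; exact: is_deriveB.
have phi'E : derive1 phi = fun s => dstep x e s - dstep y e s.
  by apply/funext => s; rewrite derive1E; apply: derive_val.
have cphi : continuous (phi : R -> R).
  by move=> s; apply: differentiable_continuous; apply/derivable1_diffP;
    have [] := dphi s.
have supp_phi s : phi s != 0 -> x <= s <= y + e.
  apply: contraNT; rewrite negb_and -!ltNge => /orP[sx|sy]; apply/eqP.
    by rewrite /phi !step_le ?subr0//; lra.
  by rewrite /phi !step_ge ?subrr//; lra.
have cl : closure [set s | phi s != 0] `<=` `[x, y + e].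
  rewrite [X in _ `<=` X](iffLR (closure_id _)); last exact: itv_closed.
  by apply: closure_subset => s /supp_phi /=; rewrite in_itv.
have phiC1 : C1c `]A, B[ phi.
  split.
  - by move=> s; have [] := dphi s.
  - rewrite phi'E => s; apply: cvgB; exact: continuous_dstep.
  - apply: (subclosed_compact _ (@segment_compact _ x (y + e))) => //.
    exact: closed_closure.
  - move=> s /cl /=; rewrite !in_itv/= => /andP[? ?]; apply/andP; split; lra.
have := uv _ phiC1; rewrite phi'E.
have cd z : {within `[A, B], continuous (fun s => u s * dstep z e s)}.
  move=> s; apply: cvgM; [exact: cu|].
  exact: (continuous_subspaceT (@continuous_dstep _ z e)).
under eq_Rintegral do rewrite mulrBr.
rewrite RintegralB//; try exact: continuous_integrable_oo.
have hx := Rintegral_dstep_approx cu Ax e0 xB ux.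
have hy := Rintegral_dstep_approx cu Ay e0 yB uy.
set Ix := Rintegral _ _ _ in hx *; set Iy := Rintegral _ _ _ in hy *.
set I := \int[mu]_(s in _) (v s * phi s) => IE.
suff HI : `|I| <= lam / 2 * \int[mu]_(s in `]A, B[) (v s ^+ 2)
     + (y - x + e) / (2 * lam).
  exact: (num _ _ _ _ _ _ IE hx hy HI).
pose J : set R := [set` `[x, y + e]].
have iJ : mu.-integrable `]A, B[ (EFin \o (\1_J : R -> R)).
  apply: (@le_integrable _ _ _ mu _ _ _ (EFin \o cst 1)) => //.
  - apply/measurable_EFinP; apply: measurable_indic; exact: measurable_itv.
  - by move=> s _; rewrite /= lee_fin indicE normr1 ger0_norm// lern1 leq_b1.
  - apply: continuous_integrable_oo => s; exact: cvg_cst.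
pose g s := lam / 2 * v s ^+ 2 + (2 * lam)^-1 * \1_J s.
have ig1 : mu.-integrable `]A, B[ (EFin \o (fun s => lam / 2 * v s ^+ 2)).
  exact: (@integrableZl _ _ _ mu _ _ (lam / 2) (fun s => (v s ^+ 2)%:E)).
have ig2 : mu.-integrable `]A, B[ (EFin \o (fun s => (2 * lam)^-1 * \1_J s)).
  exact: (@integrableZl _ _ _ mu _ _ (2 * lam)^-1 (EFin \o \1_J)).
have ig : mu.-integrable `]A, B[ (EFin \o g) by exact: (integrableD _ ig1 ig2).
have vg s : `|v s * phi s| <= g s.
  rewrite /g; have [p0|/supp_phi ps] := eqVneq (phi s) 0.
    rewrite p0 mulr0 normr0 addr_ge0// mulr_ge0 ?sqr_ge0 ?indicE//.
    by rewrite divr_ge0// ltW.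
    by rewrite invr_ge0 mulr_ge0// ltW.
  rewrite indicE mem_set ?mulr1; last by rewrite /J /= in_itv.
  have phi1 : `|phi s| <= 1.
    have := step_itv x e s; have := step_itv y e s.
    by rewrite /phi ler_norml => /andP[? ?] /andP[? ?]; apply/andP; split; lra.
  rewrite normrM (le_trans (ler_wpM2l _ phi1))// mulr1 -(real_normK (num_real (v s))).
  move: (`|v s|) => z.
  rewrite -subr_ge0.
  have -> : lam / 2 * z ^+ 2 + (2 * lam)^-1 - z = (lam * z - 1) ^+ 2 / (2 * lam).
    by field; rewrite gt_eqF.
  by rewrite divr_ge0 ?sqr_ge0// mulr_ge0// ltW.
have ivp : mu.-integrable `]A, B[ (EFin \o (fun s => v s * phi s)).
  apply: (le_integrable _ _ _ ig) => //.
    apply/measurable_EFinP; apply: measurable_funM => //.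
    by apply: measurable_funTS; exact: continuous_measurable_fun.
  by move=> s _; rewrite lee_fin (le_trans (vg s))// ler_norm.
apply: (le_trans (le_normr_Rintegral _ ivp)) => //.
apply: (@le_trans _ _ (\int[mu]_(s in `]A, B[) g s)).
  by apply: le_Rintegral => //; exact: integrable_norm.
rewrite RintegralD// !RintegralZl// lerD2l mulrC ler_wpM2r//.
  by rewrite invr_ge0 mulr_ge0// ltW.
rewrite /Rintegral integral_indic//; last exact: measurable_itv.
rewrite (_ : J `&` _ = J); last first.
  apply/setIidPl => s; rewrite /J /= !in_itv/= => /andP[? ?]; apply/andP; split; lra.
have muJ : mu J = (y - x + e)%:E.
  have := @lebesgue_measure_itv R `[x, (y + e)].
  rewrite /= lte_fin ifT; last by lra.
  by move=> ->; rewrite -EFinB addrAC.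
by rewrite -[leRHS]/(fine (y - x + e)%:E) -muJ; exact: lexx.
Qed.

(** Young's inequality with a free parameter replaces the Cauchy-Schwarz bound
[|u y - u x|^2 <= |y - x| * int v^2], whose optimal form is recovered by
minimizing in [lam].  Keeping [lam] free is what the applications need: [lam]
tends to infinity when [v = 0], and it is the weight of the final absorption
otherwise. *)
Lemma weak_deriv_osc (A B lam : R) (u v : R -> R) :
  {within `[A, B], continuous u} -> L2_space mu `]A, B[ v ->
  weak_deriv_of `]A, B[ u v -> 0 < lam ->
  forall x y, A < x < B -> A < y < B ->
  `|u y - u x| <= lam / 2 * \int[mu]_(s in `]A, B[) (v s ^+ 2)
     + `|y - x| / (2 * lam).
Proof.
move=> cu L2v uv lam0 x y.
wlog xy : x y / x <= y.
  move=> H xAB yAB; have /orP[xy|yx] := le_total x y; first exact: H.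
  by rewrite distrC (distrC y); exact: H.
move=> /andP[Ax xB] /andP[Ay yB].
rewrite (ger0_norm (_ : 0 <= y - x)) ?subr_ge0//.
apply/ler_addgt0Pr => eps eps0.
(* the error of the approximate bound is [e / (2 lam) + 2 eta <= k * eta] *)
pose k := (2 * lam)^-1 + 2.
have k0 : 0 < k by rewrite addr_gt0// invr_gt0 mulr_gt0.
pose eta := eps / k.
have eta0 : 0 < eta by rewrite divr_gt0.
have near_u z : A < z < B -> exists2 r, 0 < r &
    forall s, z <= s < z + r -> s <= B -> `|u s - u z| <= eta.
  move=> /andP[Az zB].
  have /subspace_continuousP/(_ z) := cu.
  move=> /(_ _)/cvgrPdist_le/(_ _ eta0); rewrite near_withinE.
  case; first by rewrite /= in_itv/= !ltW.
  move=> r /= r0 H; exists r => // s /andP[zs sr] sB.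
  rewrite distrC; apply: H => /=; first by rewrite ltr_norml; apply/andP; split; lra.
  by rewrite in_itv/=; apply/andP; split; lra.
have [|r1 r10 H1] := near_u x; first by rewrite Ax.
have [|r2 r20 H2] := near_u y; first by rewrite Ay.
pose e := Num.min (Num.min (r1 / 2) (r2 / 2)) (Num.min ((B - y) / 2) eta).
have e0 : 0 < e by rewrite /e !lt_min !divr_gt0 ?subr_gt0.
have : e <= e by [].
rewrite {2}/e !le_min => /andP[/andP[e1 e2] /andP[e3 e4]].
have := @weak_deriv_osc_approx A B lam x y e eta u v cu L2v uv lam0 Ax xy e0.
have -> : y + e < B by lra.
move=> /(_ isT) H; apply: (le_trans (H _ _)).
- by move=> s /andP[? ?]; apply: H1; [apply/andP; split|]; lra.
- by move=> s /andP[? ?]; apply: H2; [apply/andP; split|]; lra.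
move: (lam / 2 * _) => D.
have -> : eps = eta / (2 * lam) + 2 * eta.
  by rewrite /eta /k; field; rewrite -/k !gt_eqF//; nra.
have : e / (2 * lam) <= eta / (2 * lam).
  by rewrite ler_wpM2r// invr_ge0 mulr_ge0// ltW.
by rewrite [(y - x + e) / _]mulrDl; lra.
Qed.

End oscillation.

(** * Derivatives relative to an interval and weak constancy *)

Section relative_derivatives.
Context {R : realType}.
Local Notation mu := (@lebesgue_measure R).

Lemma derivable_in_continuous (D : set R) (f : R -> R) :
  (forall x, D x -> derivable_in D f x) -> {within D, continuous f}.
Proof.
move=> df; apply/subspace_continuousP => x Dx.
have /cvg_ex[/= l dl] := df _ Dx.
have h0 : (fun y => f x + diffq f x y * (y - x)) @ within D x^' --> f x.
  rewrite -[X in _ --> X]addr0 -[X in _ + X](mulr0 l).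
  apply: cvgD; first exact: cvg_cst.
  apply: cvgM => //; rewrite -(subrr x); apply: cvgB; last exact: cvg_cst.
  apply: cvg_trans (cvg_within _) _.
  exact: cvg_within.
apply/cvgrPdist_le => e e0; rewrite near_withinE.
move/cvgrPdist_le : h0 => /(_ _ e0); rewrite near_withinE nearE => -[r /= r0 h0].
exists r => // y /= xy Dy.
have [->|yx] := eqVneq y x; first by rewrite subrr normr0 ltW.
have /= := h0 _ xy yx Dy.
by rewrite /diffq mulfVK ?subr_eq0// [f x + (_ - _)]addrC subrK.
Qed.

(** Limits along this filter, such as those defining [deriv_in], are unique only
because the interval accumulates at each of its points. *)
Lemma within_dnbhs_itv_proper (A B x : R) : A < B -> A <= x <= B ->
  ProperFilter (within `[A, B] x^').
Proof.
move=> AB /andP[Ax xB]; apply: Build_ProperFilter_ex => P.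
rewrite /within /= => -[r /= r0 rP].
have [xltB|] := ltP x B.
  pose y := x + Num.min (r / 2) (B - x).
  have m0 : 0 < Num.min (r / 2) (B - x) by rewrite lt_min divr_gt0//= subr_gt0.
  have m1 : Num.min (r / 2) (B - x) <= r / 2 by rewrite ge_min lexx.
  have m2 : Num.min (r / 2) (B - x) <= B - x by rewrite ge_min lexx orbT.
  exists y; apply: rP => /=; rewrite ?in_itv/= /y.
  - by rewrite opprD addrA subrr sub0r normrN gtr0_norm//; lra.
  - by apply/eqP; lra.
  - by apply/andP; split; lra.
move=> Bx.
pose y := x - Num.min (r / 2) (x - A).
have m0 : 0 < Num.min (r / 2) (x - A) by rewrite lt_min divr_gt0//= subr_gt0; lra.
have m1 : Num.min (r / 2) (x - A) <= r / 2 by rewrite ge_min lexx.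
have m2 : Num.min (r / 2) (x - A) <= x - A by rewrite ge_min lexx orbT.
exists y; apply: rP => /=; rewrite ?in_itv/= /y.
- by rewrite opprB addrC subrK gtr0_norm//; lra.
- by apply/eqP; lra.
- by apply/andP; split; lra.
Qed.

Lemma derivable_in_derive1 (D : set R) (f : R -> R) (x : R) :
  derivable f x 1 -> diffq f x @ within D x^' --> derive1 f x.
Proof.
move=> df; apply: (@cvg_trans _ (diffq f x @ x^')).
  by apply: cvg_app; exact: cvg_within.
apply/cvgrPdist_le => e e0.
have : h^-1 *: (f (h + x) - f x) @[h --> 0^'] --> derive1 f x.
  have : cvg (h^-1 *: (f (h + x) - f x) @[h --> 0^']); last by [].
  by move: df; rewrite /derivable; under eq_fun do rewrite [_ *: 1]mulr1.
move=> /cvgrPdist_le/(_ _ e0)[r /= r0 rP].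
exists r => // y /= xy yx; have := rP (y - x); rewrite /= subrK /diffq mulrC; apply.
  by rewrite sub0r normrN distrC.
by rewrite subr_eq0.
Qed.

Lemma C1c_Rintegral_derive1 (A B : R) (phi : R -> R) : A < B ->
  C1c `]A, B[ phi -> \int[mu]_(s in `]A, B[) derive1 phi s = 0.
Proof.
move=> AB [dphi cphi' _ supp].
have cphi : continuous (phi : R -> R).
  by move=> s; apply: differentiable_continuous; apply/derivable1_diffP.
have phi0 s : s \notin `]A, B[ -> phi s = 0.
  apply: contraNeq => ps; apply: (supp s); exact: subset_closure.
have cd : {within `[A, B], continuous (derive1 phi)}.
  exact: continuous_subspaceT.
rewrite Rintegral_itv_bndo_bndc; last exact: continuous_integrable_oo.
rewrite Rintegral_itv_obnd_cbnd; last first.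
  apply: (@integrableS _ _ _ mu `[A, B]) => //; first exact: subset_itv_oc_cc.
  by apply: continuous_compact_integrable => //; exact: segment_compact.
rewrite /Rintegral (continuous_FTC2 (F := phi) AB)//.
- by rewrite /= !phi0 ?subr0// in_itv/= ltxx ?andbF.
- split=> //.
  + by apply: cvg_at_right_filter; exact: cphi.
  + by apply: cvg_at_left_filter; exact: cphi.
Qed.

Lemma L2_space_cst (A B c : R) : L2_space mu `]A, B[ (cst c).
Proof.
split; first exact: measurable_cst.
by apply: (@continuous_integrable_oo _ A B (cst (c ^+ 2))) => s; exact: cvg_cst.
Qed.

Lemma H1_space_cst (A B c : R) : A < B -> H1_space `]A, B[ (cst c).
Proof.
move=> AB; split; first exact: L2_space_cst.
exists (cst 0); split; first exact: L2_space_cst.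
move=> phi phiC1; have := phiC1 => -[_ cphi' _ _].
rewrite RintegralZl//; last first.
  by apply: continuous_integrable_oo; exact: continuous_subspaceT.
rewrite C1c_Rintegral_derive1// mulr0 /Rintegral integral0_eq ?oppr0// => s _.
by rewrite mul0r.
Qed.

Lemma constant_continuous_closure (A B : R) (f : R -> R) : A < B ->
  {within `[A, B], continuous f} ->
  (forall x y, A < x < B -> A < y < B -> f x = f y) -> f A = f B.
Proof.
move=> AB cf fE; pose c := (A + B) / 2.
suff H z : A <= z <= B -> f z = f c by rewrite !H ?lexx ?ltW.
move=> zAB; apply/eqP; rewrite -subr_eq0 -normr_le0; apply/ler_addgt0Pr => e e0.
rewrite add0r; have /subspace_continuousP/(_ z) := cf.
move=> /(_ _)/cvgrPdist_le/(_ _ e0); rewrite near_withinE.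
case; first by rewrite /= in_itv.
move=> r /= r0 H; move: zAB => /andP[Az zB].
have [zc|cz] := leP z c.
- pose y := z + Num.min (r / 2) ((B - A) / 4).
  have m0 : 0 < Num.min (r / 2) ((B - A) / 4) by rewrite lt_min !divr_gt0 ?subr_gt0.
  have m1 : Num.min (r / 2) ((B - A) / 4) <= r / 2 by rewrite ge_min lexx.
  have m2 : Num.min (r / 2) ((B - A) / 4) <= (B - A) / 4 by rewrite ge_min lexx orbT.
  rewrite (fE c y); [|by rewrite /c; apply/andP; split; lra|
                      by rewrite /y /c in zc *; apply/andP; split; lra].
  apply: H; rewrite /= ?in_itv/= /y.
    by rewrite opprD addrA subrr sub0r normrN gtr0_norm//; lra.
  by rewrite /c in zc; apply/andP; split; lra.
- pose y := z - Num.min (r / 2) ((B - A) / 4).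
  have m0 : 0 < Num.min (r / 2) ((B - A) / 4) by rewrite lt_min !divr_gt0 ?subr_gt0.
  have m1 : Num.min (r / 2) ((B - A) / 4) <= r / 2 by rewrite ge_min lexx.
  have m2 : Num.min (r / 2) ((B - A) / 4) <= (B - A) / 4 by rewrite ge_min lexx orbT.
  rewrite (fE c y); [|by rewrite /c; apply/andP; split; lra|
                      by rewrite /y /c in cz *; apply/andP; split; lra].
  apply: H; rewrite /= ?in_itv/= /y.
    by rewrite opprB addrC subrK gtr0_norm//; lra.
  by rewrite /c in cz; apply/andP; split; lra.
Qed.

(** The oscillation bound reads [|f y - f x| <= |y - x| / (2 lam)] for every
[lam], so [f] is constant in the interior, hence up to the endpoints. *)
Lemma weak_deriv0_constant (A B : R) (f : R -> R) : A < B ->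
  {within `[A, B], continuous f} -> weak_deriv_of `]A, B[ f (cst 0) -> f A = f B.
Proof.
move=> AB cf f0; apply: (constant_continuous_closure AB cf) => x y xAB yAB.
apply/esym/eqP; rewrite -subr_eq0 -normr_le0; apply/ler_addgt0Pr => e e0.
pose lam := (`|y - x| + 1) / e.
have lam0 : 0 < lam by rewrite divr_gt0// ltr_wpDl.
have := weak_deriv_osc cf (L2_space_cst A B 0) f0 lam0 xAB yAB.
rewrite [Rintegral _ _ _](_ : _ = 0); last first.
  by rewrite /Rintegral integral0_eq// => s _; rewrite expr0n.
rewrite mulr0 !add0r => /le_trans; apply.
rewrite ler_pdivrMr; last by rewrite mulr_gt0.
rewrite /lam.
have -> : e * (2 * ((`|y - x| + 1) / e)) = 2 * (`|y - x| + 1).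
  by field; rewrite gt_eqF.
by have := normr_ge0 (y - x); lra.
Qed.

End relative_derivatives.

(** * Conservation of mass *)

Section mass.
Context {R : realType}.
Local Notation mu := (@lebesgue_measure R).
Variables (a a0 a1 a2 a3 : R) (w h0 : R -> R) (T : R) (h : R * R -> R).
Hypotheses (a_gt0 : 0 < a) (T_gt0 : 0 < T).
Hypothesis h_sol : generalized_weak_solution a a0 a1 a2 a3 w h0 T h.

Let NaLa : - a < a. Proof. by rewrite -subr_gt0 opprK addr_gt0. Qed.

Lemma slice_continuous t : 0 <= t <= T -> {within `[- a, a], continuous (slice h t)}.
Proof.
move=> tT; apply: (@hoelder_in_continuous _ _ (1 / 2)) => //.
have [C hC] := gws_hoelder h_sol; exists C => x y.
rewrite /= !in_itv/= => xa ya.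
by have := hC (x, t) (y, t) (conj xa tT) (conj ya tT);
  rewrite /= subrr normr0 powR0 ?addr0// gt_eqF.
Qed.

Lemma mass_continuous :
  {within `[0, T], continuous (fun t => \int[mu]_(x in Omega a) h (x, t))}.
Proof.
apply: (@hoelder_in_continuous _ _ (1 / 8)) => //.
have [C hC] := gws_hoelder h_sol; exists (C * fine (mu (Omega a))) => t s.
rewrite /= !in_itv/= => tT sT.
have ct := slice_continuous tT; have cs := slice_continuous sT.
have cts : {within `[- a, a], continuous (fun x => h (x, t) - h (x, s))}.
  by move=> x; apply: cvgB; [exact: ct|exact: cs].
rewrite -RintegralB; [|exact: measurable_itv|
  exact: continuous_integrable_oo|exact: continuous_integrable_oo].
have its := continuous_integrable_oo cts.
apply: (le_trans (le_normr_Rintegral _ its)); first exact: measurable_itv.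
rewrite mulrAC -Rintegral_cst; last exact: measurable_itv.
apply: le_Rintegral.
- exact: measurable_itv.
- exact: (integrable_norm its).
- by apply: continuous_integrable_oo => x; exact: cvg_cst.
- move=> x; rewrite /= in_itv/= => /andP[/ltW xa /ltW ax].
  have xa' : - a <= x <= a by rewrite xa.
  by have := hC (x, t) (x, s) (conj xa' tT) (conj xa' sT);
    rewrite /= subrr normr0 powR0 ?add0r// gt_eqF.
Qed.

Lemma deriv_in_cst (c x : R) : - a <= x <= a ->
  derivable_in (Omega_bar a) (cst c) x /\ deriv_in (Omega_bar a) (cst c) x = 0.
Proof.
move=> xa; have PF := within_dnbhs_itv_proper NaLa xa.
have H : diffq (cst c) x @ within (Omega_bar a) x^' --> (0 : R).
  rewrite (_ : diffq (cst c) x = cst 0); first exact: cvg_cst.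
  by apply/funext => y; rewrite /diffq subrr mul0r.
by split; [apply/cvg_ex; exists 0|exact: cvg_lim].
Qed.

Lemma dx_time (eta : R -> R) z : QT_bar a T z -> dx a 1 (fun z => eta z.2) z = 0.
Proof. by move=> [za _]; exact: (deriv_in_cst (eta z.2) za).2. Qed.

(** Functions of time alone, being trivially periodic in space, thus become
admissible test functions in the weak formulation. *)
Lemma Cn1_time (eta : R -> R) : C1c (`]0, T[) eta ->
  Cn1 a T (QT_bar a T) 1 (fun z => eta z.2).
Proof.
move=> [deta ceta' _ _].
have ceta : continuous (eta : R -> R).
  by move=> s; apply: differentiable_continuous; apply/derivable1_diffP.
have dtE z : QT_bar a T z -> dt T (fun z => eta z.2) z = derive1 eta z.2.
  move=> [_ zT]; have PF := within_dnbhs_itv_proper T_gt0 zT.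
  by apply: cvg_lim => //; exact: derivable_in_derive1.
split.
- by move=> [|k]// _ z [za _]; have [] := deriv_in_cst (eta z.2) za.
- move=> [|[|k]]// _.
    apply: continuous_subspaceT => z.
    apply: (@continuous_comp _ _ _ snd eta); [exact: cvg_snd|exact: ceta].
  apply: (@subspace_eq_continuous _ _ _ (cst 0)).
    by move=> z /set_mem zQ; apply/esym; exact: dx_time.
  by move=> z; exact: cvg_cst.
- move=> z _; apply/cvg_ex; exists (derive1 eta z.2); exact: derivable_in_derive1.
- apply: (@subspace_eq_continuous _ _ _ (fun z => derive1 eta z.2)).
    by move=> z /set_mem zQ; apply/esym; exact: dtE.
  apply: continuous_subspaceT => z.
  by apply: (@continuous_comp _ _ _ snd (derive1 eta)); [exact: cvg_snd|exact: ceta'].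
Qed.

(** For the test function [eta t] both flux integrals of the weak formulation
vanish, and by linearity of [xi t] what remains is the pairing of the time
derivative of the mass with [eta]. *)
Lemma mass_weak_deriv0 :
  weak_deriv_of `]0, T[ (fun t => \int[mu]_(x in Omega a) h (x, t)) (cst 0).
Proof.
move=> eta etaC.
have [xi [[[sn [_ xiX]] _] xi_h weak]] := gws_weak h_sol.
have := weak _ (Cn1_time etaC) (fun _ _ => erefl).
(* both integrals over space-time contain the factor [phi_x = 0] *)
rewrite [X in _ - X - _](_ : _ = 0); last first.
  rewrite /Rintegral integral0_eq// => z [zQ _ _].
  by rewrite dx_time// mulr0.
rewrite [X in a3 * X](_ : _ = 0); last first.
  rewrite /Rintegral integral0_eq// => z [/andP[? ?] /andP[? ?]].
  by rewrite dx_time ?mulr0//; split; rewrite !ltW.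
rewrite mulr0 !subr0 => xi0.
have H1c := H1_space_cst 1 NaLa.
have H10 := H1_space_cst 0 NaLa.
have := xi_h (cst 1) eta H1c etaC.
under eq_Rintegral do under eq_Rintegral do rewrite mulr1.
move=> ->.
rewrite [RHS](_ : _ = - 0); last first.
  by rewrite /Rintegral integral0_eq// => s _; rewrite mul0r.
congr (- _); rewrite -[RHS]xi0 /Rintegral; congr fine; apply: eq_integral_ae.
(* [xi t] is linear for almost every [t], so [xi t (eta t) = eta t * xi t 1] *)
case: xiX => N [mN N0 sub]; exists N; split => //; apply: subset_trans sub => t.
apply: contra_not => /= xiX; rewrite in_itv/= => /xiX[[lin _] _].
congr EFin.
have xi0t : xi t (cst 0) = 0.
  have := lin 1 _ _ H10 H10; rewrite mul1r.
  rewrite (_ : (fun x => _) = cst 0); last first.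
    by apply/funext => x /=; rewrite mulr0 addr0.
  by move=> /eqP; rewrite -subr_eq subrr => /eqP.
have := lin (eta t) _ _ H1c H10; rewrite xi0t addr0.
rewrite (_ : (fun x => _) = slice (fun z => eta z.2) t); last first.
  by apply/funext => x /=; rewrite /slice mulr1 addr0.
by rewrite mulrC.
Qed.

Lemma mass_conservation :
  \int[mu]_(x in Omega a) h (x, T) = \int[mu]_(x in Omega a) h0 x.
Proof.
rewrite -(weak_deriv0_constant T_gt0 mass_continuous mass_weak_deriv0).
apply: eq_Rintegral => x /set_mem; rewrite /Omega /= in_itv/= => /andP[? ?].
by rewrite (gws_initial h_sol)// !ltW.
Qed.

End mass.

(** * Interpolation between the mass and the Dirichlet integral *)

Section interpolation.
Context {R : realType}.
Local Notation mu := (@lebesgue_measure R).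

(** Each point [x] lies in the closure of an open subinterval of length [d], on
which [u x] exceeds [u] by at most the oscillation; the average of [u] over that
subinterval is at most the total integral divided by [d], as [u >= 0]. *)
Lemma weak_deriv_average_bound (A B lam d : R) (u v : R -> R) :
  {within `[A, B], continuous u} -> (forall x, A < x < B -> 0 <= u x) ->
  L2_space mu `]A, B[ v -> weak_deriv_of `]A, B[ u v ->
  0 < lam -> 0 < d <= B - A ->
  forall x, A < x < B ->
  u x <= (\int[mu]_(s in `]A, B[) u s) / d
         + (lam / 2 * \int[mu]_(s in `]A, B[) (v s ^+ 2) + d / (2 * lam)).
Proof.
move=> cu u0 L2v uv lam0 /andP[d0 dAB] x /andP[Ax xB].
have osc := weak_deriv_osc cu L2v uv lam0.
move: osc; set b0 := lam / 2 * _ => osc.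
set b := b0 + d / (2 * lam).
(* the subinterval is ]c, c + d[: it ends at [x], unless that leaves the domain *)
pose c := Num.max A (x - d).
have Ac : A <= c by rewrite le_max lexx.
have xdc : x - d <= c by rewrite le_max lexx orbT.
have cx : c <= x by rewrite ge_max; apply/andP; split; lra.
have cdB : c + d <= B by rewrite -lerBrDr ge_max; apply/andP; split; lra.
have JS : `]c, (c + d)[ `<=` `]A, B[.
  by move=> y /=; rewrite !in_itv/= => /andP[? ?]; apply/andP; split; lra.
have iu := continuous_integrable_oo cu.
have mJ : measurable (`]c, (c + d)[ : set R) by exact: measurable_itv.
have mD : measurable (`]A, B[ : set R) by exact: measurable_itv.
have iuJ : mu.-integrable `]c, (c + d)[ (EFin \o u).
  exact: (@integrableS _ _ _ mu `]A, B[).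
have icJ k : mu.-integrable `]c, (c + d)[ (EFin \o cst k).
  by apply: continuous_integrable_oo => z; exact: cvg_cst.
have muJ : fine (mu `]c, (c + d)[) = d.
  rewrite lebesgue_measure_itv/= lte_fin ifT; last by lra.
  by rewrite -EFinB/= addrC addKr.
have uJ : \int[mu]_(s in `]c, (c + d)[) u s <= \int[mu]_(s in `]A, B[) u s.
  apply: fine_le; [exact: integrable_fin_num|exact: integrable_fin_num|].
  apply: ge0_subset_integral => //; first exact: (measurable_int mu).
have : \int[mu]_(s in `]c, (c + d)[) (cst (u x) s) <=
       \int[mu]_(s in `]c, (c + d)[) (u s + cst b s).
  apply: le_Rintegral => //; first exact: (integrableD _ iuJ (icJ b)).
  move=> y; rewrite /= in_itv/= => /andP[cy yc].
  have yx : `|x - y| <= d by rewrite ler_norml; apply/andP; split; lra.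
  have yAB : A < y < B by apply/andP; split; lra.
  have xAB : A < x < B by apply/andP; split.
  have := osc _ _ yAB xAB; rewrite ler_norml => /andP[_].
  have : `|x - y| / (2 * lam) <= d / (2 * lam).
    by rewrite ler_wpM2r// invr_ge0 mulr_ge0// ltW.
  by rewrite /b; lra.
rewrite RintegralD// !Rintegral_cst// muJ => H.
rewrite -(ler_pM2r d0) mulrDl mulfVK ?gt_eqF//.
by apply: (le_trans H); rewrite lerD2r.
Qed.

Lemma weak_deriv_interpolation (A B lam d : R) (u v : R -> R) :
  {within `[A, B], continuous u} -> (forall x, A < x < B -> 0 <= u x) ->
  L2_space mu `]A, B[ v -> weak_deriv_of `]A, B[ u v ->
  0 < lam -> 0 < d <= B - A ->
  \int[mu]_(s in `]A, B[) (u s ^+ 2) <=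
  \int[mu]_(s in `]A, B[) u s *
  (\int[mu]_(s in `]A, B[) u s / d +
   (lam / 2 * \int[mu]_(s in `]A, B[) (v s ^+ 2) + d / (2 * lam))).
Proof.
move=> cu u0 L2v uv lam0 dAB.
have bnd := weak_deriv_average_bound cu u0 L2v uv lam0 dAB.
set b := (X in _ * X); rewrite -RintegralZr//; last exact: continuous_integrable_oo.
apply: le_Rintegral => //.
- apply: continuous_integrable_oo => s; apply: cvgM; exact: cu.
- apply: continuous_integrable_oo => s; apply: cvgMl; exact: cu.
- move=> x; rewrite /= in_itv/= => xAB.
  by rewrite expr2 ler_wpM2l ?u0// bnd.
Qed.

(** [lam = a0 / (s M)] makes the Dirichlet term exactly [a0/4 * D].  The rest,
[M^2 (s / (2 d) + s^2 d / (4 a0))], would be smallest for [d] of the order of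
[sqrt (a0 / s)], which must be cut off at the length [L]; the cut-off is what
the term [s / (2 L)] pays for. *)
Lemma interpolation_young (a0 s L M I2 D : R) : 0 < a0 -> 0 < s -> 0 < L ->
  0 <= M -> 0 <= D ->
  (forall lam d, 0 < lam -> 0 < d <= L ->
     I2 <= M * (M / d + (lam / 2 * D + d / (2 * lam)))) ->
  s / 2 * I2 <= a0 / 4 * D +
    M ^+ 2 * (2 * Num.sqrt 6 * s `^ (3 / 2) / (3 * Num.sqrt a0) + s / (2 * L)).
Proof.
move=> a00 s0 L0; rewrite le_eqVlt => /predU1P[<-|M0] D0 H.
  (* the [lam] chosen below needs [M > 0] *)
  have := H 1 L ltr01; rewrite L0 lexx mul0r => /(_ isT) I20.
  rewrite expr0n /= mul0r addr0; apply: (@le_trans _ _ 0).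
    by rewrite pmulr_rle0// divr_gt0.
  by rewrite mulr_ge0// divr_ge0// ltW.
pose p := Num.sqrt s; pose q := Num.sqrt a0.
have p0 : 0 < p by rewrite sqrtr_gt0.
have q0 : 0 < q by rewrite sqrtr_gt0.
have sE : s = p ^+ 2 by rewrite sqr_sqrtr// ltW.
have a0E : a0 = q ^+ 2 by rewrite sqr_sqrtr// ltW.
have s32 : s `^ (3 / 2) = p ^+ 3.
  rewrite (_ : 3 / 2 = 2^-1 * 3%:R); last by lra.
  by rewrite powRrM powR_mulrn ?powR_ge0// powR12_sqrt ?(ltW s0).
pose d := Num.min L (q / p).
have qp0 : 0 < q / p by rewrite divr_gt0.
have d0 : 0 < d by rewrite lt_min L0.
have dL : d <= L by rewrite ge_min lexx.
have dqp : d <= q / p by rewrite ge_min lexx orbT.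
have dV : d^-1 <= L^-1 + p / q.
  rewrite /d minEle; case: ifP => _; first by rewrite lerDl divr_ge0// ltW.
  by rewrite invf_div lerDr invr_ge0 ltW.
have lam0 : 0 < a0 / (s * M) by rewrite divr_gt0// mulr_gt0.
have := H _ d lam0; rewrite d0 dL => /(_ isT) {}H.
have s20 : 0 < s / 2 by rewrite divr_gt0.
apply: (@le_trans _ _ (s / 2 * (M * (M / d + (a0 / (s * M) / 2 * D +
   d / (2 * (a0 / (s * M)))))))).
  by rewrite ler_pM2l.
have -> : s / 2 * (M * (M / d + (a0 / (s * M) / 2 * D +
   d / (2 * (a0 / (s * M)))))) =
   a0 / 4 * D + M ^+ 2 * (s / 2 * d^-1 + s ^+ 2 / (4 * a0) * d).
  by field; rewrite !gt_eqF.
rewrite lerD2l ler_pM2l ?exprn_gt0//.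
apply: (@le_trans _ _ (s / 2 * (L^-1 + p / q) + s ^+ 2 / (4 * a0) * (q / p))).
  apply: lerD; first by rewrite ler_pM2l.
  by rewrite ler_pM2l// divr_gt0// ?exprn_gt0// mulr_gt0.
rewrite s32 -/q sE a0E.
have -> : p ^+ 2 / 2 * (L^-1 + p / q) + (p ^+ 2) ^+ 2 / (4 * q ^+ 2) * (q / p) =
  3 / 4 * (p ^+ 3 / q) + p ^+ 2 / (2 * L).
  by field; rewrite !gt_eqF.
rewrite lerD2r.
have -> : 2 * Num.sqrt 6 * p ^+ 3 / (3 * q) = 2 / 3 * Num.sqrt 6 * (p ^+ 3 / q).
  by field; rewrite gt_eqF.
rewrite ler_pM2r ?divr_gt0 ?exprn_gt0//.
have : 2 <= Num.sqrt 6 :> R.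
  rewrite -(@ler_pXn2r _ 2) ?nnegrE ?sqrtr_ge0// sqr_sqrtr//; lra.
by lra.
Qed.

Lemma ler_supnorm (A B : R) (w : R -> R) x : A <= B ->
  {within `[A, B], continuous w} -> A < x < B -> `|w x| <= supnorm `]A, B[ w.
Proof.
move=> AB cw xAB.
have cnw : {within `[A, B], continuous (fun x => `|w x|)}.
  by move=> s; apply: cvg_norm; exact: cw.
have [c _ cP] := EVT_max AB cnw.
apply: ub_le_sup; last by exists x; rewrite //= in_itv.
exists `|w c| => _ [y /= yAB <-]; apply: cP.
exact: subset_itv_oo_cc yAB.
Qed.

Lemma wderivP (D : set R) (u : R -> R) : H1_space D u ->
  L2_space mu D (wderiv D u) /\ weak_deriv_of D u (wderiv D u).
Proof.
move=> [_ /(xgetPex (cst 0))]; exact.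
Qed.

(** The zeroth order term of the [H^1] norm turns [a1/2] into [(a0 + a1)/2], up
to a term of favourable sign; this is why [K3] depends on the sign of
[a0 + a1]. *)
Lemma energy_coercive (a a0 a1 a2 : R) (w u : R -> R) : 0 < a -> 0 < a0 ->
  {within `[- a, a], continuous w} -> {within `[- a, a], continuous u} ->
  (forall x, - a < x < a -> 0 <= u x) -> H1_space (Omega a) u ->
  ((a0 / 4 * H1norm (Omega a) u ^+ 2)%:E <= energy a a0 a1 a2 w u +
    (K3 a a0 a1 a2 w (\int[mu]_(x in Omega a) u x))%:E)%E.
Proof.
move=> a_gt0 a00 cw cu u0 H1u.
have [L2v uv] := wderivP H1u.
have [L2u _] := H1u.
rewrite /energy asboolT// -EFinD lee_fin.
set v := wderiv _ _ in L2v uv *.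
have NaLa : - a < a by lra.
set M := \int[mu]_(x in _) u x.
pose I2 := \int[mu]_(x in Omega a) (u x ^+ 2).
pose D := \int[mu]_(x in Omega a) (v x ^+ 2).
pose W := \int[mu]_(x in Omega a) (w x * u x).
have mO : measurable (Omega a) by exact: measurable_itv.
have iu : mu.-integrable (Omega a) (EFin \o u) by exact: continuous_integrable_oo.
have cwu : {within `[- a, a], continuous (fun x => w x * u x)}.
  by move=> s; apply: cvgM; [exact: cw|exact: cu].
have iwu : mu.-integrable (Omega a) (EFin \o (fun x => w x * u x)).
  exact: continuous_integrable_oo.
have iu2 : mu.-integrable (Omega a) (EFin \o (fun x => u x ^+ 2)) by have [_] := L2u.
have iv2 : mu.-integrable (Omega a) (EFin \o (fun x => v x ^+ 2)) by have [_] := L2v.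
have iZ k f : mu.-integrable (Omega a) (EFin \o f) ->
    mu.-integrable (Omega a) (EFin \o (fun x => k * f x)).
  move=> If; exact: (@integrableZl _ _ _ mu _ _ k (EFin \o f)).
have iB f g : mu.-integrable (Omega a) (EFin \o f) ->
    mu.-integrable (Omega a) (EFin \o g) ->
    mu.-integrable (Omega a) (EFin \o (fun x => f x - g x)).
  move=> If Ig; exact: (integrableB _ If Ig).
have NE : H1norm (Omega a) u ^+ 2 = I2 + D.
  rewrite /H1norm sqr_sqrtr; last first.
    by apply: Rintegral_ge0 => x _; rewrite addr_ge0 ?sqr_ge0.
  by rewrite RintegralD.
have EE : \int[mu]_(x in Omega a)
    (a0 * v x ^+ 2 - a1 * u x ^+ 2 - 2 * a2 * w x * u x) =
    a0 * D - a1 * I2 - 2 * a2 * W.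
  under eq_Rintegral do rewrite -mulrA.
  rewrite RintegralB//; [|by apply: (iB (fun x => a0 * v x ^+ 2)); exact: iZ|exact: iZ].
  rewrite RintegralB//; [|exact: iZ|exact: iZ].
  by rewrite !RintegralZl.
have M0 : 0 <= M.
  by apply: Rintegral_ge0 => x; rewrite /Omega /= in_itv/= => /u0.
have D0 : 0 <= D by apply: Rintegral_ge0 => x _; rewrite sqr_ge0.
have I20 : 0 <= I2 by apply: Rintegral_ge0 => x _; rewrite sqr_ge0.
have WM : `|W| <= supnorm (Omega a) w * M.
  apply: (le_trans (le_normr_Rintegral _ iwu)) => //.
  rewrite -RintegralZl//; apply: le_Rintegral => //.
  - exact: (integrable_norm iwu).
  - exact: iZ.
  - move=> x; rewrite /Omega /= in_itv/= => xa.
    rewrite normrM (ger0_norm (u0 _ xa)) ler_wpM2r ?u0//.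
    by apply: ler_supnorm => //; exact: ltW.
have a2W : a2 * W <= `|a2| * supnorm (Omega a) w * M.
  by rewrite (le_trans (ler_norm _))// normrM -mulrA ler_wpM2l.
rewrite NE EE /K3 /=.
have muO : fine (mu (Omega a)) = 2 * a.
  rewrite lebesgue_measure_itv/= lte_fin ifT// -EFinB/=; lra.
rewrite muO.
move: a2W; set wM := _ * _ * M => a2W.
clearbody wM W.
case: ifPn => [s0|]; first nra.
rewrite -ltNge => s0.
have L0 : 0 < 2 * a by lra.
have := @interpolation_young a0 (a0 + a1) (2 * a) M I2 D a00 s0 L0 M0 D0.
set k := M ^+ 2 * _ => /(_ _) young.
suff : (a0 + a1) / 2 * I2 <= a0 / 4 * D + k.
  clearbody k I2 D; nra.
apply: young => lam d lam0 dL.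
apply: weak_deriv_interpolation => //.
by rewrite opprK -mulr2n -[a *+ 2]mulr_natl.
Qed.

End interpolation.

(** * The bound on the H^1 norm *)

Theorem lemma4p2 (R : realType) (a a0 a1 a2 a3 gamma : R) (w h0 : R -> R)
    (Tloc C : R) (h : R * R -> R)
    (a_gt0 : 0 < a) (a0_gt0 : 0 < a0)
    (gamma01 : 0 < gamma < 1)
    (w_reg : Cn_hoelder (Omega_bar a) 2 gamma w)
    (w_per : forall i, (i <= 2)%N ->
       nderiv_in (Omega_bar a) i w (- a) = nderiv_in (Omega_bar a) i w a)
    (h0_H1 : H1_space (Omega a) h0)
    (h0_ge0 : forall x, - a <= x <= a -> 0 <= h0 x)
    (h0_inv : (\int[@lebesgue_measure R]_(x in Omega a) ((h0 x)%:E^-1) < +oo)%E)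
    (h0_bdry :
       (h0 (- a) = 0 /\ h0 a = 0) \/
       [/\ h0 (- a) = h0 a, h0 a != 0,
           nderivable_at (Omega_bar a) 3 h0 (- a),
           nderivable_at (Omega_bar a) 3 h0 a &
           forall i, (1 <= i <= 3)%N ->
             nderiv_in (Omega_bar a) i h0 (- a) =
             nderiv_in (Omega_bar a) i h0 a])
    (Tloc_gt0 : 0 < Tloc)
    (h_sol : generalized_weak_solution a a0 a1 a2 a3 w h0 Tloc h)
    (h_ge0 : forall z, QT_bar a Tloc z -> 0 <= h z)
    (h_H2 : L2_bochner (H2_space (Omega a)) (H2norm (Omega a)) Tloc (slice h)) :
  let K : R :=
    `|a2 * a3| * supnorm (Omega a) (nderiv_in (Omega_bar a) 1 w) * C in
  let M : R := \int[@lebesgue_measure R]_(x in Omega a) h0 x in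
  (energy a a0 a1 a2 w (slice h Tloc) + dissipation a a0 a1 a2 w Tloc h
     <= energy a a0 a1 a2 w h0 + (K * Tloc)%:E)%E ->
  H1_space (Omega a) (slice h Tloc) /\
  ((a0 / 4 * H1norm (Omega a) (slice h Tloc) ^+ 2)%:E
     <= energy a a0 a1 a2 w h0 + (K * Tloc + K3 a a0 a1 a2 w M)%:E)%E.
Proof.
move=> K M energy_le.
have E0E : energy a a0 a1 a2 w h0 \is a fin_num by rewrite /energy asboolT.
have diss0 : (0 <= dissipation a a0 a1 a2 w Tloc h)%E.
  apply: integral_ge0 => z [_ hz]; rewrite lee_fin mulr_ge0 ?sqr_ge0//.
  by rewrite exprn_ge0// ltW.
have H1u : H1_space (Omega a) (slice h Tloc).
  apply: contrapT => nH1; move: energy_le.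
  rewrite {1}/energy asboolF// addye; last by rewrite gt_eqF// (lt_le_trans _ diss0).
  by rewrite -(fineK E0E) -EFinD leye_eq.
split=> //.
have TT : 0 <= Tloc <= Tloc by rewrite lexx ltW.
have cw : {within `[- a, a], continuous w}.
  exact: (derivable_in_continuous (w_reg.1 0%N isT)).
have u0 x : - a < x < a -> 0 <= slice h Tloc x.
  by move=> /andP[? ?]; apply: h_ge0; split=> //=; rewrite !ltW.
apply: (le_trans (energy_coercive a1 a2 a_gt0 a0_gt0 cw
  (slice_continuous h_sol TT) u0 H1u)).
rewrite (mass_conservation a_gt0 Tloc_gt0 h_sol) EFinD addeA leeD2r//.
by apply: le_trans energy_le; rewrite leeDl.
Qed.
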